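(* Let $f\in\mathbb{Z}[x]$ be a monic irreducible polynomial of degree $N$, and let $\mathfrak{a}=\langle f\rangle\subseteq\mathbb{Z}[x]$. Then there is a polynomial time reduction from $\mathfrak{a}\text{-}SCP$ to $\mathfrak{a}\text{-}SSub$ (with the same approximation factor $\gamma$).
   Context: Let $\mathcal{V}(\mathfrak{a})=\{a^{(1)},\ldots,a^{(N)}\}\subset\mathbb{C}$ be the set of zeros of $f$, and let $a\in\mathcal{V}(\mathfrak{a})$, so that $\mathbb{Z}[a]\cong\mathbb{Z}[x]/\mathfrak{a}$. For $\alpha\in\mathbb{Z}[a]$, $\mathrm{maxConj}(\alpha)$ is the maximum of the absolute values of the zeros in $\mathbb{C}$ of the minimal polynomial of $\alpha$ over $\mathbb{Q}$. The problem $\mathfrak{a}\text{-}SCP_\gamma$ (approximate smallest conjugate problem): given (generators of) an ideal $I\subseteq\mathbb{Z}[a]$, find a nonzero $\alpha\in I$ such that $\mathrm{maxConj}(\alpha)\le\gamma\,\mathrm{maxConj}(\alpha')$ for all nonzero $\alpha'\in I$. For $\alpha=\sum_{i=0}^{N-1}\alpha_i a^i\in\mathbb{Z}[a]$ ($\alpha_i\in\mathbb{Z}$), define $\mathrm{maxsub}(\alpha)=\max_{1\le j\le N}\bigl|\sum_{i=0}^{N-1}\alpha_i (a^{(j)})^i\bigr|$. The problem $\mathfrak{a}\text{-}SSub_\gamma$ (approximate smallest substitution problem): given (generators of) an ideal $I\subseteq\mathbb{Z}[a]$, find a nonzero $\alpha\in I$ such that $\mathrm{maxsub}(\alpha)\le\gamma\,\mathrm{maxsub}(\alpha')$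 for all nonzero $\alpha'\in I$. *)

(* Defs.v *)
From Corelib Require Import BinNums.
From HB Require Import structures.
From mathcomp Require Import all_boot all_order all_algebra.
From mathcomp Require Import boolp classical_sets reals.
From mathcomp Require Import complex.

Set Implicit Arguments.
Unset Strict Implicit.
Unset Printing Implicit Defensive.

Import Order.TTheory GRing.Theory Num.Theory.

Local Open Scope ring_scope.

(** * Search problems and polynomial-time (Cook) reductions *)

(** [is_instance] is the promise on the inputs; [is_solution x y] is only
    meaningful for [x] satisfying it. *)
Record search_problem (A : finType) := SearchProblem {
  instance : Type;
  solution : Type;
  instance_code : instance -> seq A;
  solution_code : solution -> seq A;
  is_instance : instance -> Prop;
  is_solution : instance -> solution -> Prop
}.

Definition solves (A : finType) (P : search_problem A) (O : seq A -> seq A) :=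
  forall x : instance P, is_instance x ->
  exists2 y : solution P, O (instance_code x) = solution_code y
                        & is_solution x y.

(** Deterministic multitape Turing machines with an oracle. The tapes are
    infinite to the right only; a move to the left from cell 0 stays there.
    A tape is the sequence of its cells, blank ([None]) beyond the end of the
    sequence, together with the position of the head. *)
Inductive move := MoveLeft | Stay | MoveRight.

Record tape (A : Type) := Tape { cells : seq (option A); head_pos : nat }.

Definition tape_of (A : Type) (w : seq A) : tape A := Tape (map Some w) 0.

Definition read (A : Type) (t : tape A) : option A :=
  nth None (cells t) (head_pos t).

Definition write (A : Type) (t : tape A) (a : option A) (m : move) : tape A :=
  Tape (set_nth None (cells t) (head_pos t) a)
       (match m with
        | MoveLeft => (head_pos t).-1
        | Stay => head_pos t
        | MoveRight => (head_pos t).+1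
        end).

(** The word before the first blank. *)
Fixpoint word_before_blank (A : Type) (s : seq (option A)) : seq A :=
  if s is Some a :: s' then a :: word_before_blank s' else [::].

Definition word_on (A : Type) (t : tape A) : seq A := word_before_blank (cells t).

(** Tape 0 holds the input, tape 1 is the oracle tape, tape 2 holds the output;
    there are [work_tapes] further tapes. *)
Record oracle_machine (A : finType) := OracleMachine {
  work_tapes : nat;
  state : finType;
  start_state : state;
  query_state : state;
  answer_state : state;
  halt_state : state;
  transition : state -> ('I_work_tapes.+3 -> option A) ->
               state * ('I_work_tapes.+3 -> option A * move)
}.

Section Run.
Variables (A : finType) (M : oracle_machine A) (O : seq A -> seq A).

Definition input_tape : 'I_(work_tapes M).+3 := inord 0.
Definition oracle_tape : 'I_(work_tapes M).+3 := inord 1.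
Definition output_tape : 'I_(work_tapes M).+3 := inord 2.

Record config := Config {
  config_state : state M;
  config_tape : 'I_(work_tapes M).+3 -> tape A
}.

Definition start_config (w : seq A) : config :=
  Config (start_state M)
         (fun i => tape_of (if i == input_tape then w else [::])).

(** In the query state, the word on the oracle tape is replaced by the answer
    of the oracle in a single step. *)
Definition step (c : config) : config :=
  let: Config q t := c in
  if q == halt_state M then c
  else if q == query_state M then
    Config (answer_state M)
           (fun i => if i == oracle_tape
                     then tape_of (O (word_on (t oracle_tape))) else t i)
  else
    let: (q', act) := transition q (fun i => read (t i)) in
    Config q' (fun i => write (t i) (act i).1 (act i).2).

Definition outputs_within (T : nat) (w v : seq A) :=
  let: Config q t := iter T step (start_config w) in
  q = halt_state M /\ word_on (t output_tape) = v.

End Run.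

(** [P] reduces to [Q]: a single oracle machine solves [P] in polynomial time
    whatever oracle solving [Q] it is given. As usual for search problems the
    answers of the oracle are polynomially bounded ([r] below); otherwise
    merely reading an answer could exceed every polynomial in the size of the
    input. The polynomial [p] has to be the same for all such oracles. *)
Definition poly_time_reducible (A : finType) (P Q : search_problem A) :=
  exists M : oracle_machine A,
  forall r : {poly nat}, exists p : {poly nat},
  forall O : seq A -> seq A,
    solves Q O -> (forall q, (size (O q) <= r.[size q])%N) ->
  forall x : instance P, is_instance x ->
  exists2 y : solution P,
    outputs_within M O p.[size (instance_code x)]
                   (instance_code x) (solution_code y)
    & is_solution x y.

(** * Binary codes of integer vectors and of lists of integer vectors *)

Inductive symbol := Digit0 | Digit1 | Minus | EndInt | EndVec.

Definition symbol_to_ord (s : symbol) : 'I_5 :=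
  inord (match s with
         | Digit0 => 0 | Digit1 => 1 | Minus => 2 | EndInt => 3 | EndVec => 4
         end).

Definition ord_to_symbol (i : 'I_5) : symbol :=
  nth Digit0 [:: Digit0; Digit1; Minus; EndInt; EndVec] i.

Lemma symbol_to_ordK : cancel symbol_to_ord ord_to_symbol.
Proof. by case; rewrite /ord_to_symbol /symbol_to_ord inordK. Qed.

HB.instance Definition _ := Finite.copy symbol (can_type symbol_to_ordK).

(** Least significant digit first. *)
Fixpoint pos_code (p : positive) : seq symbol :=
  match p with
  | xH => [:: Digit1]
  | xO p' => Digit0 :: pos_code p'
  | xI p' => Digit1 :: pos_code p'
  end.

Definition nat_code (n : nat) : seq symbol :=
  if bin_of_nat n is Npos p then pos_code p else [:: Digit0].

Definition int_code (m : int) : seq symbol :=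
  match m with
  | Posz n => nat_code n
  | Negz n => Minus :: nat_code n.+1
  end.

Definition vec_code (N : nat) (v : 'rV[int]_N) : seq symbol :=
  flatten [seq rcons (int_code (v 0 i)) EndInt | i <- enum 'I_N].

Definition vecs_code (N : nat) (gs : seq 'rV[int]_N) : seq symbol :=
  flatten [seq rcons (vec_code g) EndVec | g <- gs].

(** * The ring Z[a] and its ideals *)

(** Irreducibility in the ring Z[x]; [irreducible_poly] at [int] is about
    pseudo-divisibility, that is, irreducibility over the rationals. *)
Definition irreducible_in_Zx (f : {poly int}) :=
  [/\ f != 0, f \isn't a GRing.unit
    & forall g h : {poly int}, f = g * h ->
        g \is a GRing.unit \/ h \is a GRing.unit].

Section Problems.
Variable R : realType.
Local Notation C := R[i].

Definition absC (z : C) : R := complex.Re `|z|.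

Definition zeros (K : nzRingType) (h : K -> C) (p : {poly K}) : set C :=
  [set z | root (map_poly h p) z].

(** An element of Z[a] is represented by its coordinates in the basis
    1, a, ..., a ^ (N-1); [subst v z] substitutes [z] for [a]. *)
Definition subst (N : nat) (v : 'rV[int]_N) (z : C) : C :=
  \sum_(i < N) (v 0 i)%:~R * z ^+ i.

Definition in_ideal (N : nat) (a : C) (gs : seq 'rV[int]_N) (alpha : C) :=
  exists c : 'I_(size gs) -> 'rV[int]_N,
    alpha = \sum_(k < size gs) subst (c k) a * subst gs`_k a.

(** The polynomial 0 if [z] is not algebraic. *)
Definition minpolyQ (z : C) : {poly rat} :=
  xget 0 [set q : {poly rat} |
    [/\ q \is monic, zeros ratr q z
      & forall p : {poly rat}, p != 0 -> zeros ratr p z ->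
          (size q <= size p)%N]].

(** The suprema below are over finite nonempty sets (for algebraic [alpha],
    resp. nonconstant [f]), hence are maxima. *)
Definition maxConj (alpha : C) : R :=
  sup [set absC z | z in zeros ratr (minpolyQ alpha)].

Definition maxsub (N : nat) (f : {poly int}) (v : 'rV[int]_N) : R :=
  sup [set absC (subst v z) | z in zeros intr f].

(** Given generators of a nonzero ideal of Z[a], find a nonzero element of it
    that minimizes [mu] up to the factor [gamma]. The zero ideal is excluded
    since it contains no nonzero element. *)
Definition smallest_element_problem (N : nat) (a : C)
    (mu : 'rV[int]_N -> R) (gamma : R) : search_problem symbol :=
  @SearchProblem symbol (seq 'rV[int]_N) 'rV[int]_N
    (@vecs_code N) (@vec_code N)
    (fun gs => exists2 alpha, in_ideal a gs alpha & alpha != 0)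
    (fun gs v =>
       [/\ in_ideal a gs (subst v a), subst v a != 0
         & forall v' : 'rV[int]_N,
             in_ideal a gs (subst v' a) -> subst v' a != 0 ->
             mu v <= gamma * mu v']).

Definition SCP (N : nat) (a : C) (gamma : R) : search_problem symbol :=
  smallest_element_problem a
    (fun v : 'rV[int]_N => maxConj (subst v a)) gamma.

Definition SSub (N : nat) (f : {poly int}) (a : C) (gamma : R) :
    search_problem symbol :=
  smallest_element_problem a (@maxsub N f) gamma.

End Problems.

(* Main.v *)
Require Import Defs.
From mathcomp Require Import all_boot all_order all_algebra.
From mathcomp Require Import boolp classical_sets reals complex.
From mathcomp Require Import zify.

(** Both problems minimize over the same ideal, and their objectives agree:
    for alpha = P(a) the zeros of the minimal polynomial of alpha are exactly
    the values of P at the zeros of f. Indeed f divides minpoly(P(x)), as f is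
    irreducible over the rationals by Gauss' lemma; conversely the resultant in
    x of f(x) and P(x) - y vanishes at y = alpha, so it is divisible by
    minpoly(y), and its zeros are the values of P at the zeros of f. So the
    reduction just forwards its input to the oracle and returns the answer. *)

Set Implicit Arguments.
Unset Strict Implicit.
Unset Printing Implicit Defensive.

Import GRing.Theory.
Local Open Scope ring_scope.

(** * Copying a word from one tape to another *)

(** Cells are compared pointwise, as writing a blank may leave trailing [None] cells that equality
    of sequences would see. *)
Definition holds_word (A : Type) (t : tape A) (w : seq A) :=
  forall i, nth None (cells t) i = nth None (map Some w) i.

Lemma holds_word_on (A : Type) (t : tape A) (w : seq A) :
  holds_word t w -> word_on t = w.
Proof.
rewrite /holds_word /word_on; elim: (cells t) w => [|b s IHs] [|x w] //= eq_s.
- by have:= eq_s 0.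
- by have:= eq_s 0; rewrite /= => ->.
- by have:= eq_s 0 => /= ->; rewrite (IHs w) // => i; apply: (eq_s i.+1).
Qed.

Lemma holds_write_read (A : Type) (t : tape A) (w : seq A) (m : move) :
  holds_word t w -> holds_word (write t (read t) m) w.
Proof.
move=> tw i; rewrite /write /read /= nth_set_nth /=.
by case: eqP => [->|_]; rewrite tw.
Qed.

Lemma holds_write_rcons (A : Type) (t : tape A) (w : seq A) (x : A) (m : move) :
  holds_word t w -> head_pos t = size w ->
  holds_word (write t (Some x) m) (rcons w x).
Proof.
move=> tw tE i; rewrite /write /= nth_set_nth /= map_rcons nth_rcons size_map tE.
by rewrite tw; case: ltngtP => // lt_i; rewrite nth_default // size_map ltnW.
Qed.

Section Copy.
Variables (A : finType) (M : oracle_machine A) (O : seq A -> seq A).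

(** Every tape must be written at each step, so a tape left alone rewrites the symbol it reads and
    stays. *)
Definition copy_action (I : eqType) (src dst : I) (r : I -> option A) (i : I) :
    option A * move :=
  if r src is Some x then
    if i == dst then (Some x, MoveRight)
    else (r i, if i == src then MoveRight else Stay)
  else (r i, Stay).

Variables (q q' : state M) (src dst : 'I_(work_tapes M).+3).
Hypotheses (q_halt : q != halt_state M) (q_query : q != query_state M).
Hypothesis src_dst : src != dst.
Hypothesis copyM : forall r : 'I_(work_tapes M).+3 -> option A,
  transition q r = (if r src is Some _ then q else q', copy_action src dst r).

(** Induction on [w], the part still to copy, with [u] already copied. One step beyond [size w] is
    spent reading the blank after the word and changing state. *)
Lemma copy_run (u w : seq A) (t : 'I_(work_tapes M).+3 -> tape A) :
    holds_word (t src) (u ++ w) -> head_pos (t src) = size u ->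
    holds_word (t dst) u -> head_pos (t dst) = size u ->
  exists t', [/\ iter (size w).+1 (step O) (Config q t) = Config q' t',
    holds_word (t' dst) (u ++ w)
    & forall j, j != src -> j != dst -> head_pos (t' j) = head_pos (t j) /\
        forall v, holds_word (t j) v -> holds_word (t' j) v].
Proof.
elim: w u t => [|x w IHw] u t src_w src_u dst_w dst_u.
  rewrite cats0 in src_w *.
  have read_src: read (t src) = None.
    by rewrite /read src_u src_w nth_default // size_map.
  eexists; split.
  - by rewrite /= (negPf q_halt) (negPf q_query) copyM /copy_action read_src.
  - by rewrite /=; apply: holds_write_read.
  by move=> j _ _; split=> //= v; apply: holds_write_read.
have read_src: read (t src) = Some x.
  by rewrite /read src_u src_w map_cat nth_cat size_map ltnn subnn.
pose act := copy_action src dst (fun i => read (t i)).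
pose t1 i := write (t i) (act i).1 (act i).2.
have step_t: step O (Config q t) = Config q t1.
  by rewrite /= (negPf q_halt) (negPf q_query) copyM read_src.
have [||||t' [run_t' dst_t' oth_t']] := IHw (rcons u x) t1.
- rewrite cat_rcons /t1 /act /copy_action read_src (negPf src_dst) /=.
  by rewrite -read_src; apply: holds_write_read.
- by rewrite /t1 /act /copy_action read_src (negPf src_dst) eqxx /= src_u size_rcons.
- by rewrite /t1 /act /copy_action read_src eqxx /=; apply: holds_write_rcons.
- by rewrite /t1 /act /copy_action read_src eqxx /= dst_u size_rcons.
exists t'; split; first by rewrite /= -iterS iterSr step_t.
  by rewrite -cat_rcons.
move=> j jsrc jdst; have [-> keep_j] := oth_t' j jsrc jdst.
rewrite /t1 /act /copy_action read_src (negPf jdst) (negPf jsrc) /= in keep_j *.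
by split=> // v tv; apply: keep_j; apply: holds_write_read.
Qed.

End Copy.

(** * The machine relaying its input to the oracle *)

Lemma iter_step_halt (A : finType) (M : oracle_machine A) (O : seq A -> seq A)
    (k : nat) (t : 'I_(work_tapes M).+3 -> tape A) :
  iter k (step O) (Config (halt_state M) t) = Config (halt_state M) t.
Proof. by elim: k => //= k ->; rewrite /= eqxx. Qed.

(** States: 0 copies the input to the oracle tape, 1 queries, 2 copies the
    answer to the output tape, 3 halts. *)
Definition relay_machine (A : finType) : oracle_machine A :=
  @OracleMachine A 0 'I_4 (inord 0) (inord 1) (inord 2) (inord 3)
    (fun q r =>
       if q == inord 0 then
         (if r (inord 0) is Some _ then q else inord 1,
          copy_action (inord 0) (inord 1) r)
       else
         (if r (inord 1) is Some _ then q else inord 3,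
          copy_action (inord 1) (inord 2) r)).

Lemma eq_inord (n i j : nat) :
  (i <= n)%N -> (j <= n)%N -> (inord i == inord j :> 'I_n.+1) = (i == j).
Proof. by move=> lei lej; rewrite -val_eqE /= !inordK. Qed.

(** Copying takes [size w + 1] and [size (O w) + 1] steps, the query one. *)
Lemma relay_machine_run (A : finType) (O : seq A -> seq A) (w : seq A) (T : nat) :
  (size w + size (O w) + 3 <= T)%N ->
  outputs_within (relay_machine A) O T w (O w).
Proof.
move=> leT; pose M := relay_machine A.
have [||||||||t1 [run1 oracle1 keep1]] := @copy_run A M O (inord 0) (inord 1)
  (inord 0) (inord 1) _ _ _ _ [::] w
  (fun i => tape_of (if i == input_tape M then w else [::])).
1-8: rewrite ?eq_inord //.
- by move=> r /=; rewrite eqxx.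
(* The first copy leaves the output tape blank with its head at 0, as the second copy requires. *)
have [||out1 outE1] := keep1 (inord 2); rewrite ?eq_inord //.
rewrite /input_tape !eq_inord // in out1 outE1.
pose t2 i := if i == oracle_tape M then tape_of (O w) else t1 i.
have t2_oracle : t2 (inord 1) = tape_of (O w) by rewrite /t2 eqxx.
have t2_out : t2 (inord 2) = t1 (inord 2) by rewrite /t2 /oracle_tape eq_inord.
have query : step O (Config (inord 1 : state M) t1) = Config (inord 2 : state M) t2.
  by rewrite /= !eq_inord //= (holds_word_on oracle1).
have [||||||||t3 [run3 out3 _]] := @copy_run A M O (inord 2) (inord 3)
  (inord 1) (inord 2) _ _ _ _ [::] (O w) t2.
1-8: rewrite ?eq_inord ?t2_oracle ?t2_out //.
- by move=> r /=; rewrite eq_inord.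
- exact: outE1.
have run : iter ((size (O w)).+1 + (1 + (size w).+1)) (step O) (start_config M w) =
    Config (halt_state M) t3.
  by rewrite iterD -[RHS]run3; congr iter; apply: etrans (congr1 (step O) run1) query.
(* The surplus steps come last and idle in the halting state. *)
have -> : T = (T - (size w + size (O w) + 3) + ((size (O w)).+1 + (1 + (size w).+1)))%N.
  by rewrite -[LHS](subnK leT); congr addn; lia.
rewrite /outputs_within iterD run iter_step_halt.
by split=> //; apply: holds_word_on.
Qed.

Lemma poly_time_reducible_refl (A : finType) (P : search_problem A) :
  poly_time_reducible P P.
Proof.
(* The bound [r] on the oracle's answers controls the second copy. *)
exists (relay_machine A) => r; exists ('X + r + 3%N%:P) => O solvesO sizeO x xP.
have [y Oy yP] := solvesO x xP; exists y => //.
rewrite -Oy; apply: relay_machine_run.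
by rewrite !hornerE leq_add2r leq_add2l; apply: sizeO.
Qed.

(** * Conjugates of an element of Z[a] *)

Section Algebra.
Variable R : realType.
Local Notation C := R[i].

Lemma map_ratr_intr (p : {poly int}) :
  map_poly (ratr : rat -> C) (map_poly intr p) = map_poly intr p.
Proof.
by rewrite -map_poly_comp; apply: eq_map_poly => c; rewrite /= ratr_int.
Qed.

(** The gcd of f and g over Q vanishes at [a]. By Gauss' lemma it is a rational multiple of an
    integral factor [h] of f, so irreducibility makes it associate to f. *)
Lemma irreducible_dvdp_rat (f : {poly int}) (a : C) (g : {poly rat}) :
    irreducible_in_Zx f -> root (map_poly intr f) a -> root (map_poly ratr g) a ->
  map_poly intr f %| g.
Proof.
case=> f_neq0 _ irr_f fa ga; pose fQ : {poly rat} := map_poly intr f.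
have root_gcd : root (map_poly (ratr : rat -> C) (gcdp fQ g)) a.
  by rewrite gcdp_map root_gcd map_ratr_intr fa.
have [h [c c_neq0 gcdE] [k fE]] := dvdpP_rat_int (dvdp_gcdl fQ g).
have kU : k \is a GRing.unit.
  (* A unit [h] would be a nonzero constant, which cannot vanish at [a]. *)
  have [hU|//] := irr_f _ _ fE.
  move: root_gcd; rewrite gcdE map_polyZ map_ratr_intr rootZ ?fmorph_eq0 //.
  move: hU; rewrite poly_unitE => /andP[/size_poly1P[d d_neq0 ->] _].
  by rewrite map_polyC rootC intr_eq0 (negPf d_neq0).
rewrite -[map_poly _ f]/fQ (dvdp_trans _ (dvdp_gcdr fQ g)) // gcdE.
have [d d_neq0 kE] : exists2 d, d != 0 & k = d%:P.
  by move: kU; rewrite poly_unitE => /andP[/size_poly1P].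
rewrite dvdpZr // /fQ fE kE mulrC mul_polyC map_polyZ /=.
by rewrite dvdpZl ?intr_eq0.
Qed.

Lemma minpolyQP (z : C) (g : {poly rat}) : g != 0 -> root (map_poly ratr g) z ->
  root (map_poly ratr (minpolyQ z)) z /\
  forall p : {poly rat}, root (map_poly ratr p) z -> minpolyQ z %| p.
Proof.
move=> g_neq0 gz.
pose has_size n := `[< exists p : {poly rat},
  [/\ p != 0, root (map_poly (ratr : rat -> C) p) z & size p = n] >].
have ex_size : exists n, has_size n by exists (size g); apply/asboolP; exists g.
have [n /asboolP[p [p_neq0 pz size_p]] min_n] := ex_minnP ex_size.
rewrite /minpolyQ; case: xgetP => [m _ [m_monic mz m_min]|]; last first.
  (* The default value of [xget] is excluded: a polynomial of least size vanishing at [z], made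
     monic, satisfies the specification. *)
  move/(_ ((lead_coef p)^-1 *: p)); case; split.
  - by rewrite monicE lead_coefZ mulVf ?lead_coef_eq0.
  - by rewrite /zeros /= map_polyZ rootZ // fmorph_eq0 invr_eq0 lead_coef_eq0.
  move=> q q_neq0 qz; rewrite size_scale ?invr_eq0 ?lead_coef_eq0 // size_p.
  by apply: min_n; apply/asboolP; exists q.
split=> // q qz; apply: contraT; rewrite /dvdp => r_neq0.
(* A nonzero remainder would vanish at [z] and be smaller than [m]. *)
suff: (size m <= size (modp q m))%N by rewrite leqNgt ltn_modp monic_neq0.
apply: m_min r_neq0 _.
move: qz; rewrite /zeros /= {1}(divp_eq q m) rmorphD rmorphM /= !rootE hornerD hornerM.
by rewrite (rootP mz) mulr0 add0r.
Qed.

(** The resultant in x of f(x) and P(x) - y: the inner variable is y. *)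
Definition image_poly (f P : {poly rat}) : {poly rat} :=
  resultant (map_poly polyC f) (map_poly polyC P - 'X%:P).

(** Over C a resultant vanishes exactly when there is a common root. As P is monic and nonconstant,
    P(x) - y stays monic in x, so specializing y commutes with the resultant. *)
Lemma root_image_poly (f P : {poly rat}) (y : C) :
    f \is monic -> P \is monic -> (1 < size P)%N ->
  root (map_poly ratr (image_poly f P)) y <->
  exists2 x, root (map_poly ratr f) x & (map_poly ratr P).[x] = y.
Proof.
move=> f_monic P_monic size_P.
(* Specialization of the inner variable at the number [y]. *)
pose ev : {rmorphism {poly rat} -> C} := horner_eval y \o map_poly ratr.
have evC q : map_poly ev (map_poly polyC q) = map_poly ratr q.
  rewrite -map_poly_comp; apply: eq_map_poly => c.
  by rewrite /ev /= map_polyC /horner_eval hornerC.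
have -> : root (map_poly ratr (image_poly f P)) y =
    (resultant (map_poly ratr f) (map_poly ratr P - y%:P) == 0).
  have lead_P : lead_coef (map_poly polyC P - 'X%:P) = 1.
    by rewrite lead_coefDl ?size_polyN ?size_map_polyC ?(leq_ltn_trans (size_polyC_leq1 _)) //
               lead_coef_map_inj ?(monicP P_monic) //; apply: polyC_inj.
  rewrite rootE -[_.[y]]/(ev _) map_resultant.
  - by rewrite rmorphB /= !evC map_polyC /ev /= map_polyX /horner_eval hornerX.
  - by rewrite lead_coef_map_inj ?(monicP f_monic) ?rmorph1 ?oner_eq0 //; apply: polyC_inj.
  - by rewrite lead_P rmorph1 oner_eq0.
rewrite resultant_eq0; split=> [gcd_size|[x fx Px]].
  have /closed_rootP[x] : size (gcdp (map_poly ratr f) (map_poly ratr P - y%:P)) != 1%N.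
    by rewrite gtn_eqF.
  rewrite root_gcd => /andP[fx /rootP Px]; exists x => //.
  by move/eqP: Px; rewrite hornerD hornerN hornerC subr_eq0 => /eqP.
apply: (@root_size_gt1 _ x); last first.
  by rewrite root_gcd fx rootE hornerD hornerN hornerC Px subrr eqxx.
by rewrite gcdp_eq0 map_poly_eq0 negb_and monic_neq0.
Qed.

Lemma zeros_minpolyQ (f : {poly int}) (a : C) (P : {poly int}) :
    f \is monic -> irreducible_in_Zx f -> root (map_poly intr f) a ->
    (size P < size f)%N ->
  zeros ratr (minpolyQ (map_poly intr P : {poly C}).[a]) =
  [set (map_poly intr P : {poly C}).[z] | z in @zeros R _ intr f]%classic.
Proof.
move=> f_monic irr_f fa size_P.
pose fQ : {poly rat} := map_poly intr f.
(* Adding f keeps the values of P at the zeros of f and makes P monic, so that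
   the degrees in the resultant do not drop when y is specialized. *)
pose Q := P + f; pose QQ : {poly rat} := map_poly intr Q.
have size_f : (1 < size f)%N.
  have -> : size f = size (map_poly (intr : int -> C) f).
    by rewrite size_map_inj_poly //; apply: intr_inj.
  by apply: root_size_gt1 fa; rewrite map_poly_eq0_id0 ?monic_neq0 ?(monicP f_monic) ?oner_eq0.
have fQ_monic : fQ \is monic by apply: monic_map.
have size_Q : size QQ = size f.
  by rewrite size_map_inj_poly //; [rewrite /Q addrC size_polyDl | apply: intr_inj].
have QQ_monic : QQ \is monic.
  by apply: monic_map; rewrite monicE /Q addrC lead_coefDl // (monicP f_monic).
have QE z : root (map_poly (ratr : rat -> C) fQ) z ->
    (map_poly (ratr : rat -> C) QQ).[z] = (map_poly intr P).[z].
  rewrite !map_ratr_intr => /rootP fz.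
  by rewrite rmorphD hornerD fz addr0.
have image_root := fun y => @root_image_poly fQ QQ y fQ_monic QQ_monic.
rewrite size_Q in image_root.
set y := _.[a].
(* A polynomial expression in the algebraic number [a] is algebraic; this yields the nonzero
   polynomial needed for [minpolyQP]. *)
have y_algebraic : algebraicOver (ratr : rat -> C) y.
  apply/integral_algebraic/(integral_horner_root (p := map_poly ratr fQ)).
  - exact: monic_map.
  - by rewrite map_ratr_intr.
  - by apply/integral_poly => i; rewrite coef_map; apply: integral_id.
  - by rewrite -map_ratr_intr; apply/integral_poly => i; rewrite coef_map; apply: integral_id.
have [g g_neq0 gy] := y_algebraic.
have [min_y min_dvd] := minpolyQP g_neq0 gy.
have image_y : root (map_poly ratr (image_poly fQ QQ)) y.
  by apply/image_root => //; exists a; rewrite ?QE // map_ratr_intr.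
apply/seteqP; split=> [w mw|_ [z fz <-]]; rewrite /zeros /=.
  (* Each conjugate of [y] is a root of the resultant, hence a value at a zero of f. *)
  have := min_dvd _ image_y.
  rewrite -(dvdp_map (ratr : {rmorphism rat -> C})) => /root_dvdp/(_ mw).
  by case/(image_root w size_f).1=> z fz <-; exists z; rewrite ?QE -?map_ratr_intr.
(* Conversely, the composite vanishes at [a], hence at every zero of f. *)
have : fQ %| minpolyQ y \Po QQ.
  apply: (irreducible_dvdp_rat irr_f fa).
  by rewrite map_comp_poly root_comp /= QE // map_ratr_intr.
rewrite -(dvdp_map (ratr : {rmorphism rat -> C})) => /(root_dvdp (x := z)).
by rewrite map_comp_poly root_comp QE map_ratr_intr //; apply.
Qed.

Lemma maxConj_subst (N : nat) (f : {poly int}) (a : R[i]) (v : 'rV[int]_N) :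
    f \is monic -> irreducible_in_Zx f -> size f = N.+1 ->
    root (map_poly intr f) a ->
  maxConj (subst v a) = maxsub R f v.
Proof.
move=> f_monic irr_f size_f fa.
(* Substitution evaluates a polynomial with at most N coefficients, whose size is below [size f]. *)
have substE z : subst v z = (map_poly intr (rVpoly v)).[z].
  rewrite /rVpoly poly_def rmorph_sum horner_sum; apply: eq_bigr => i _.
  by rewrite /= valK map_polyZ map_polyXn hornerZ hornerXn.
rewrite /maxConj /maxsub; congr sup.
rewrite substE (zeros_minpolyQ f_monic) // ?size_f ?ltnS ?size_poly //.
by rewrite image_comp; apply: eq_imagel => z _; rewrite /= substE.
Qed.
End Algebra.

Theorem theorem6p5 (R : realType) (N : nat) (f : {poly int}) (a : R[i])
    (gamma : R) :
  f \is monic -> irreducible_in_Zx f -> size f = N.+1 ->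
  root (map_poly intr f) a ->
  poly_time_reducible (SCP N a gamma) (SSub N f a gamma).
Proof.
move=> f_monic irr_f size_f fa; rewrite /SCP.
(* With equal objective functions the two search problems coincide, for any [gamma]. *)
have -> : (fun v : 'rV[int]_N => maxConj (subst v a)) = @maxsub R N f.
  by apply: funext => v; apply: maxConj_subst.
exact: poly_time_reducible_refl.
Qed.
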